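(* The groups $\Pi_5(\mathbf{m},\mathbf{k},\mathbf{k}',\mathbf{n})$ have the $R_\infty$ property.
   Context: Let $A=[\ell_{ij}]\in\mathrm{SL}(2,\mathbb{Z})$ have trace $>2$. For $\mathbf{x}=(x,y)^t\in\mathbb{Z}^2$ write $\mathbf{a}^{\mathbf{x}}=a_1^xa_2^y$; for an integer matrix $B=[b_{ij}]$ write $B(a_i)=a_1^{b_{1i}}a_2^{b_{2i}}$. Kernels and images of integer matrices are taken on $\mathbb{Z}^2$; parameters lying in quotient groups are given by representatives in $\mathbb{Z}^2$; $[\alpha,\beta]=\alpha\beta\alpha^{-1}\beta^{-1}$. Let $M$ be a traceless integer matrix with determinant $-1$ and $MAM^{-1}=A^{-1}$, and let $\mathbf m,\mathbf k,\mathbf k',\mathbf n$ satisfy $$(\mathbf{k},\ \mathbf{n}+\mathbf{k},\ \mathbf{k}'-\mathbf{k},\ \mathbf{m}-\mathbf{n}+M(\mathbf{k}'-\mathbf{k}))\in\frac{\ker(I-M)}{\mathrm{im}(I+M)}\oplus\frac{\ker(I+M)}{\mathrm{im}(I-M)}\oplus\frac{\ker(I-A^{-1}M)}{\eta\cdot\mathrm{im}(I+MA)}\oplus\frac{\ker(A^{-1}+M)}{\mathrm{im}(A-M)}.$$ Here $\eta\in\{1,2\}$, and $\eta=2$ iff $A$ and $M$ can be conjugated simultaneously to $\begin{bmatrix}\ell'_{11}&\ell'_{12}\\ \ell'_{21}&\ell'_{22}\end{bmatrix}$ and $\begin{bmatrix}-1&1\\0&1\end{bmatrix}$ so that both $\frac{\ell'_{21}}{\gcd(\ell'_{22}-1,\ell'_{21})}$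 and $\frac{\ell'_{21}}{\gcd(\ell'_{22}+1,\ell'_{21})}$ are even. Then $$\Pi_5(\mathbf{m},\mathbf{k},\mathbf{k}',\mathbf{n})=\left\langle a_1,a_2,t,\alpha,\beta\ \middle|\ \begin{array}{l}[a_1,a_2]=1,\ ta_it^{-1}=A(a_i),\ \alpha a_i\alpha^{-1}=a_i^{-1},\ \beta a_i\beta^{-1}=M(a_i),\\ \alpha^2=1,\ \beta^2=\mathbf{a}^{\mathbf{k}},\ [\alpha,\beta]=\mathbf{a}^{\mathbf{n}},\ \alpha t\alpha^{-1}=\mathbf{a}^{\mathbf{m}}t,\ \beta t\beta^{-1}=\mathbf{a}^{\mathbf{k}'}t^{-1}\end{array}\right\rangle.$$ The Reidemeister number $R(\varphi)$ of an endomorphism $\varphi$ of a group $G$ is the number (possibly $\infty$) of equivalence classes of the relation $\alpha\sim\gamma\alpha\varphi(\gamma)^{-1}$ ($\gamma\in G$) on $G$. $G$ has the $R_\infty$ property if $R(\varphi)=\infty$ for every automorphism $\varphi$ of $G$. *)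

(* Defs.v *)
From HB Require Import structures.
From mathcomp Require Import all_boot all_order all_algebra.
From mathcomp Require Import finmap mathcomp_extra boolp classical_sets functions.
From mathcomp Require Import cardinality constructive_ereal.

Set Implicit Arguments.
Unset Strict Implicit.
Unset Printing Implicit Defensive.

Import Order.TTheory GRing.Theory Num.Theory.

Local Open Scope classical_set_scope.
Local Open Scope ring_scope.
Local Open Scope quotient_scope.

(* A word is a sequence of signed letters: (x, false) stands for x and        *)
(* (x, true) for its inverse.                                                 *)
Definition word (X : Type) := seq (X * bool).

Section Words.
Context {X : Type}.
Implicit Types (x : X) (u v w : word X).

Definition gen x : word X := [:: (x, false)].

Definition winv u : word X := rev [seq (l.1, ~~ l.2) | l <- u].

Definition wpow x (z : int) : word X := nseq `|z|%N (x, z < 0).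

Definition wconj u v : word X := u ++ v ++ winv u.

(* The convention is [u, v] = u v u^-1 v^-1, not MathComp's u^-1 v^-1 u v.    *)
Definition wcomm u v : word X := u ++ v ++ winv u ++ winv v.

Inductive word_equiv (rels : word X -> word X -> Prop) :
    word X -> word X -> Prop :=
| WRefl u : word_equiv rels u u
| WSym u v : word_equiv rels u v -> word_equiv rels v u
| WTrans u v w :
    word_equiv rels u v -> word_equiv rels v w -> word_equiv rels u w
| WCat u u' v v' :
    word_equiv rels u u' -> word_equiv rels v v' ->
    word_equiv rels (u ++ v) (u' ++ v')
| WCancel x b : word_equiv rels [:: (x, b); (x, ~~ b)] [::]
| WRel u v : rels u v -> word_equiv rels u v.

Variable rels : word X -> word X -> Prop.

Lemma winvK : involutive winv.
Proof.
move=> u; rewrite /winv map_rev revK -map_comp -[RHS]map_id.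
by apply: eq_map => -[x b] /=; rewrite negbK.
Qed.

Lemma winv_cat u v : winv (u ++ v) = winv v ++ winv u.
Proof. by rewrite /winv map_cat rev_cat. Qed.

Lemma word_equivV u : word_equiv rels (winv u ++ u) [::].
Proof.
elim: u => [|[x b] u IHu]; first exact: WRefl.
rewrite -cat1s winv_cat -catA; apply: WTrans IHu.
apply: (WCat (WRefl _ _)); rewrite catA -{2}[u]cat0s.
apply: (WCat _ (WRefl _ _)).
by have := WCancel rels x (~~ b); rewrite negbK.
Qed.

Lemma word_equiv_winv u v :
  word_equiv rels u v -> word_equiv rels (winv u) (winv v).
Proof.
move=> uv; rewrite -[winv u]cats0 -[winv v]cat0s.
apply: (@WTrans _ _ (winv u ++ (v ++ winv v))).
  apply: (WCat (WRefl _ _)); apply: WSym.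
  by rewrite -{1}[v]winvK; apply: word_equivV.
rewrite catA; apply: (WCat _ (WRefl _ _)).
apply: WTrans (word_equivV u); apply: (WCat (WRefl _ _)).
exact: WSym.
Qed.

End Words.

(* The group < X | u = v for (u, v) in rels >.                                *)
Section Presentation.
Variables (X : choiceType) (rels : word X -> word X -> Prop).

Definition word_eqb : rel (word X) := fun u v => `[< word_equiv rels u v >].

Lemma word_eqb_refl : reflexive word_eqb.
Proof. by move=> u; apply/asboolP/WRefl. Qed.

Lemma word_eqb_sym : symmetric word_eqb.
Proof. by move=> u v; apply/asboolP/asboolP => /WSym. Qed.

Lemma word_eqb_trans : transitive word_eqb.
Proof. by move=> v u w /asboolP uv /asboolP vw; apply/asboolP/(WTrans uv). Qed.

Canonical word_eqb_equiv :=
  EquivRel word_eqb word_eqb_refl word_eqb_sym word_eqb_trans.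

Definition presented := {eq_quot word_eqb}.

HB.instance Definition _ : EqQuotient _ word_eqb_equiv presented :=
  EqQuotient.on presented.
HB.instance Definition _ := Choice.on presented.

Lemma presentedP (u v : word X) :
  \pi_presented u = \pi_presented v <-> word_equiv rels u v.
Proof.
split=> [/eqP|uv]; last by apply/eqP; rewrite eqquotE; apply/asboolP.
by rewrite eqquotE => /asboolP.
Qed.

Definition presented_one : presented := \pi_presented [::].
Definition presented_mul (p q : presented) : presented :=
  \pi_presented (repr p ++ repr q).
Definition presented_inv (p : presented) : presented :=
  \pi_presented (winv (repr p)).

Lemma word_equiv_repr (u : word X) :
  word_equiv rels (repr (\pi_presented u)) u.
Proof. by apply/presentedP; rewrite reprK. Qed.

Lemma presented_mulE (u v : word X) :
  presented_mul (\pi_presented u) (\pi_presented v) = \pi_presented (u ++ v).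
Proof. by apply/presentedP/WCat; apply: word_equiv_repr. Qed.

Lemma presented_invE (u : word X) :
  presented_inv (\pi_presented u) = \pi_presented (winv u).
Proof. by apply/presentedP/word_equiv_winv/word_equiv_repr. Qed.

Lemma presented_mulA : associative presented_mul.
Proof.
elim/quotW => u; elim/quotW => v; elim/quotW => w.
by rewrite (presented_mulE v w) (presented_mulE u v) !presented_mulE catA.
Qed.

Lemma presented_mul1 : left_id presented_one presented_mul.
Proof. by elim/quotW => u; rewrite (presented_mulE [::] u). Qed.

Lemma presented_mulr1 : right_id presented_one presented_mul.
Proof. by elim/quotW => u; rewrite (presented_mulE u [::]) cats0. Qed.

Lemma presented_mulV : left_inverse presented_one presented_inv presented_mul.
Proof.
elim/quotW => u; rewrite (presented_invE u) (presented_mulE (winv u) u).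
exact/presentedP/word_equivV.
Qed.

Lemma presented_mulrV :
  right_inverse presented_one presented_inv presented_mul.
Proof.
elim/quotW => u; rewrite (presented_invE u) (presented_mulE u (winv u)).
by apply/presentedP; rewrite -{1}[u]winvK; apply: word_equivV.
Qed.

HB.instance Definition _ := isGroup.Build presented presented_mulA
  presented_mul1 presented_mulr1 presented_mulV presented_mulrV.

End Presentation.

Section Reidemeister.
Variable G : groupType.

(* The class of a is { c a phi(c)^-1 | c in G }.                              *)
Definition reidemeister_class (phi : {multiplicative G -> G}) (a : G) : set G :=
  [set (c * a * (phi c)^-1)%g | c in [set: G]].

Definition reidemeister_classes (phi : {multiplicative G -> G}) : set (set G) :=
  range (reidemeister_class phi).

Definition reidemeister_number (phi : {multiplicative G -> G}) : \bar nat :=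
  if pselect (finite_set (reidemeister_classes phi))
  then (#|` fset_set (reidemeister_classes phi)|)%fset%:E else +oo%E.

Definition R_infinity : Prop :=
  forall phi : {multiplicative G -> G},
    bijective phi -> reidemeister_number phi = +oo%E.

End Reidemeister.

Definition kerZ (B : 'M[int]_2) : set 'cV[int]_2 := [set x | B *m x = 0].

Definition imZ (B : 'M[int]_2) : set 'cV[int]_2 := range (mulmx B).

Definition cosetZ (L : set 'cV[int]_2) (x : 'cV[int]_2) : set 'cV[int]_2 :=
  [set x + y | y in L].

Definition quotientZ (K L : set 'cV[int]_2) : set (set 'cV[int]_2) :=
  [set cosetZ L x | x in K].

(* The integer vector x represents an element of K / L.                       *)
Definition represents (K L : set 'cV[int]_2) (x : 'cV[int]_2) : Prop :=
  quotientZ K L (cosetZ L x).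

Definition mx2 (a b c d : int) : 'M[int]_2 :=
  \matrix_(i < 2, j < 2)
    (if i == 0 then if j == 0 then a else b else if j == 0 then c else d).

(* Conjugation is in GL(2, Z). Both divisions are exact, and l21 != 0 as soon  *)
(* as \det A = 1 and 2 < \tr A.                                               *)
Definition eta_even (A M : 'M[int]_2) : Prop :=
  exists P : 'M[int]_2,
    let l := P *m A *m invmx P in
    let l21 := l 1 0 in
    let l22 := l 1 1 in
    [/\ P \in unitmx,
        P *m M *m invmx P = mx2 (-1) 1 0 1,
        (2 %| (l21 %/ gcdz (l22 - 1) l21)%Z)%Z &
        (2 %| (l21 %/ gcdz (l22 + 1) l21)%Z)%Z].

Definition eta (A M : 'M[int]_2) : int := if `[< eta_even A M >] then 2 else 1.

Inductive pi5_gen := Ga of 'I_2 | Gt | Galpha | Gbeta.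

HB.instance Definition _ := gen_eqMixin pi5_gen.
HB.instance Definition _ := gen_choiceMixin pi5_gen.

Section Pi5.
Variables A M : 'M[int]_2.
Variables m k k' n : 'cV[int]_2.

Definition pi5_params : Prop :=
  [/\ represents (kerZ (1%:M - M)) (imZ (1%:M + M)) k,
      represents (kerZ (1%:M + M)) (imZ (1%:M - M)) (n + k),
      represents (kerZ (1%:M - invmx A *m M))
        [set eta A M *: y | y in imZ (1%:M + M *m A)] (k' - k) &
      represents (kerZ (invmx A + M)) (imZ (A - M)) (m - n + M *m (k' - k))].

Local Notation a i := (gen (Ga i)).
Local Notation t := (gen Gt).
Local Notation alpha := (gen Galpha).
Local Notation beta := (gen Gbeta).

(* For x = (x1, x2)^t, the word a_1^x1 a_2^x2; thus B(a_i) = avec (col i B).  *)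
Definition avec (x : 'cV[int]_2) : word pi5_gen :=
  wpow (Ga 0) (x 0 0) ++ wpow (Ga 1) (x 1 0).

Inductive pi5_rel : word pi5_gen -> word pi5_gen -> Prop :=
| Rel_aa : pi5_rel (wcomm (a 0) (a 1)) [::]
| Rel_ta i : pi5_rel (wconj t (a i)) (avec (col i A))
| Rel_alphaa i : pi5_rel (wconj alpha (a i)) (winv (a i))
| Rel_betaa i : pi5_rel (wconj beta (a i)) (avec (col i M))
| Rel_alpha2 : pi5_rel (alpha ++ alpha) [::]
| Rel_beta2 : pi5_rel (beta ++ beta) (avec k)
| Rel_alphabeta : pi5_rel (wcomm alpha beta) (avec n)
| Rel_alphat : pi5_rel (wconj alpha t) (avec m ++ t)
| Rel_betat : pi5_rel (wconj beta t) (avec k' ++ winv t).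

Definition Pi5 : groupType := presented pi5_rel.

End Pi5.

(* Main.v *)
Require Import Defs.
From HB Require Import structures.
From mathcomp Require Import all_boot all_order all_algebra.
From mathcomp Require Import boolp classical_sets cardinality constructive_ereal.
From mathcomp Require Import zify ring.

Import GRing.Theory Num.Theory.
Local Open Scope ring_scope.

(** Killing a_1, a_2 and alpha maps G = Pi5 onto the infinite dihedral group
    D = < t, beta | beta^2 = 1, beta t beta^-1 = t^-1 >.  The proof shows that
    every automorphism phi of G descends to an automorphism of D, and that the
    twisted conjugacy classes are already infinite in number on D.

    Descent: more generally, every surjection f from G to D kills a_1, a_2 and
    alpha ([dih_translation_trivial], [dih_alpha_trivial]); apply this to the
    quotient map composed with phi.  The main tool is that D has trivial
    centre, so that an element commuting with the images of all five
    generators is trivial.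
    - If f(a_i) were a reflection, it would commute with each of its
      conjugates by a generator, since those are images of words in a_1, a_2.
      Two distinct reflections of D never commute, so f(a_i) would be fixed by
      every generator, hence central.  Hence f(a_i) is a rotation by some
      integer u_i.
    - Conjugation by f(t) acts on rotations by a sign c, so the relations
      t a_i t^-1 = A(a_i) say that (u_1, u_2) A = c (u_1, u_2).  Since
      det(A - c I) = 2 - c tr A is nonzero, u_1 = u_2 = 0.
    - Modulo a_1 and a_2, alpha commutes with every generator, so f(alpha) is
      central.
    What is left of the presentation forces f(t) to be a rotation by some j and
    f(beta) a reflection, and surjectivity gives j = 1 or j = -1.

    Infinitely many classes: write (x, s) for the element t^x beta^s of D.
    The induced automorphism is (y, s) |-> (j y + s b, s).  If j = 1, the
    twisted class of a rotation (x, 0) is {(x, 0), (-x - b, 0)}; if j = -1, the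
    twisted class of a reflection (x, 1) is {(x, 1), (b - x, 1)}.  In both cases
    the elements with x > |b| lie in pairwise distinct classes
    ([reidemeister_number_dihedral]). *)

(** * Homomorphisms out of a presented group *)

Definition word_eval {X : Type} {H : groupType} (f : X -> H) (w : word X) : H :=
  foldr (fun l h => ((if l.2 then (f l.1)^-1 else f l.1) * h)%g) 1%g w.

Lemma word_eval_cat {X : Type} {H : groupType} (f : X -> H) (u v : word X) :
  word_eval f (u ++ v) = (word_eval f u * word_eval f v)%g.
Proof. by elim: u => [|l u IHu] /=; rewrite ?mul1g // IHu mulgA. Qed.

Lemma word_eval_gen {X : Type} {H : groupType} (f : X -> H) (x : X) :
  word_eval f (gen x) = f x.
Proof. by rewrite /= mulg1. Qed.

Lemma word_eval_winv {X : Type} {H : groupType} (f : X -> H) (u : word X) :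
  word_eval f (winv u) = (word_eval f u)^-1%g.
Proof.
elim: u => [|[x b] u IHu]; first by rewrite /= invg1.
rewrite -cat1s winv_cat word_eval_cat IHu word_eval_cat invgM; congr (_ * _)%g.
by case: b; rewrite /= !mulg1 ?invgK.
Qed.

Lemma multiplicative1 {G H : groupType} (h : {multiplicative G -> H}) :
  h 1%g = 1%g.
Proof. by apply: (mulgI (h 1%g)); rewrite -gmulfM !mulg1. Qed.

Lemma multiplicativeV {G H : groupType} (h : {multiplicative G -> H}) (x : G) :
  h x^-1%g = (h x)^-1%g.
Proof.
by apply: (mulgI (h x)); rewrite -gmulfM !mulgV; apply: multiplicative1.
Qed.

Lemma word_eval_hom {X : Type} {G H : groupType} (h : {multiplicative G -> H})
    (f : X -> G) (w : word X) :
  h (word_eval f w) = word_eval (h \o f) w.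
Proof.
elim: w => [|[x b] w IHw] /=; first exact: multiplicative1.
by rewrite gmulfM IHw; case: b; rewrite ?multiplicativeV.
Qed.

Lemma commute_word_eval {X : Type} {H : groupType} (f : X -> H) (z : H)
    (w : word X) :
  (forall x, commute z (f x)) -> commute z (word_eval f w).
Proof.
move=> zf; elim: w => [|[x b] w IHw] /=; first exact: commute1.
by apply: commuteM => //; case: b => //=; apply: commuteV.
Qed.

Definition respects {X : Type} {H : groupType}
    (rels : word X -> word X -> Prop) (f : X -> H) : Prop :=
  forall u v, rels u v -> word_eval f u = word_eval f v.

Lemma word_eval_equiv {X : Type} {H : groupType}
    (rels : word X -> word X -> Prop) (f : X -> H) (u v : word X) :
  respects rels f -> word_equiv rels u v -> word_eval f u = word_eval f v.
Proof.
move=> fP; elim=> // {u v}; first by move=> u v w _ -> _ ->.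
- by move=> u u' v v' _ uu' _ vv'; rewrite !word_eval_cat uu' vv'.
- by move=> x [] /=; rewrite mulg1 ?mulVg ?mulgV.
Qed.

Section Lift.
Context {X : choiceType} {rels : word X -> word X -> Prop} {H : groupType}.

Definition presented_lift (f : X -> H) (fP : respects rels f)
  (p : presented rels) : H := word_eval f (repr p).

Lemma presented_liftE (f : X -> H) (fP : respects rels f) (w : word X) :
  presented_lift f fP (\pi_(presented rels) w)%qT = word_eval f w.
Proof. exact/(word_eval_equiv rels)/word_equiv_repr. Qed.

Lemma presented_liftM (f : X -> H) (fP : respects rels f) :
  {morph presented_lift f fP : p q / (p * q)%g}.
Proof. by move=> p q; rewrite [LHS]presented_liftE word_eval_cat. Qed.

HB.instance Definition _ (f : X -> H) (fP : respects rels f) :=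
  isMultiplicative.Build (presented rels) H (presented_lift f fP)
    (presented_liftM f fP).

Definition presented_gen (x : X) : presented rels :=
  (\pi_(presented rels) (gen x))%qT.

Lemma presented_word_eval (w : word X) :
  word_eval presented_gen w = (\pi_(presented rels) w)%qT.
Proof.
elim: w => [//|[x b] w IHw] /=; rewrite IHw -cat1s.
rewrite -presented_mulE; congr presented_mul.
by case: b => //; rewrite [LHS]presented_invE.
Qed.

Lemma respects_hom (h : {multiplicative presented rels -> H}) :
  respects rels (h \o presented_gen).
Proof.
move=> u v uv; rewrite -!word_eval_hom !presented_word_eval.
by congr (h _); apply/presentedP/WRel.
Qed.

Lemma presented_hom_eval (h : {multiplicative presented rels -> H})
    (p : presented rels) : h p = word_eval (h \o presented_gen) (repr p).
Proof. by rewrite -word_eval_hom presented_word_eval reprK. Qed.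

End Lift.

(** * Reidemeister numbers *)

Lemma reidemeister_number_infinite {G : groupType}
    (phi : {multiplicative G -> G}) (w : nat -> G) :
  injective (reidemeister_class phi \o w) -> reidemeister_number phi = +oo%E.
Proof.
move=> w_inj; rewrite /reidemeister_number; case: pselect => // fin.
case: infinite_nat.
apply: (sub_finite_set _ (finite_preimage (f := reidemeister_class phi \o w) _ fin)).
  by move=> i _; exists (w i).
by move=> i j _ _; apply: w_inj.
Qed.

(** * The infinite dihedral group *)

(** The pair (x, s) is the isometry y |-> x + y (s = false) or y |-> x - y
    (s = true) of the integers. *)
Definition dihedral : Type := (int * bool)%type.

HB.instance Definition _ := Choice.on dihedral.

Definition dih_one : dihedral := (0, false).
Definition dih_mul (p q : dihedral) : dihedral :=
  (p.1 + (if p.2 then - q.1 else q.1), p.2 (+) q.2).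
Definition dih_inv (p : dihedral) : dihedral :=
  (if p.2 then p.1 else - p.1, p.2).

Lemma dih_mulA : associative dih_mul.
Proof.
by move=> [x []] [y []] [z []]; congr (_, _); rewrite /=; ring.
Qed.

Lemma dih_mul1 : left_id dih_one dih_mul.
Proof. by move=> [x []]; congr (_, _); rewrite /=; ring. Qed.

Lemma dih_mulr1 : right_id dih_one dih_mul.
Proof. by move=> [x []]; congr (_, _); rewrite /=; ring. Qed.

Lemma dih_mulV : left_inverse dih_one dih_inv dih_mul.
Proof. by move=> [x []]; congr (_, _); rewrite /=; ring. Qed.

Lemma dih_mulrV : right_inverse dih_one dih_inv dih_mul.
Proof. by move=> [x []]; congr (_, _); rewrite /=; ring. Qed.

HB.instance Definition _ := isGroup.Build dihedral
  dih_mulA dih_mul1 dih_mulr1 dih_mulV dih_mulrV.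

Definition rotation (x : int) : dihedral := (x, false).
Definition reflection (x : int) : dihedral := (x, true).

Lemma dih_centerless (z : dihedral) : (forall p, commute z p) -> z = 1%g.
Proof.
case: z => x s zC; have /(congr1 fst) /= := zC (rotation 1).
have /(congr1 fst) /= := zC (reflection 0).
by case: s {zC} => /= x0 x1; [lia | congr (_, _); lia].
Qed.

(** The products of the reflections (u, true) and (v, true) in the two orders are
    the rotations by u - v and v - u, so they commute only if u = v.  A reflection
    that commutes with its conjugate by p therefore equals it. *)
Lemma commute_conj_reflection (u : int) (p : dihedral) :
  commute (reflection u) (p * reflection u * p^-1)%g ->
  commute (reflection u) p.
Proof. by case: p => y [] /(congr1 fst) /= yu; congr (_, _) => /=; lia. Qed.

(** The endomorphism sending the generating rotation to the rotation by j and
    the reflection (0, true) to (b, true). *)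
Definition dih_endo (j b : int) (p : dihedral) : dihedral :=
  (j * p.1 + (if p.2 then b else 0), p.2).

Lemma dih_endoM (j b : int) : {morph dih_endo j b : p q / (p * q)%g}.
Proof. by move=> [x []] [y []]; congr (_, _); rewrite /=; ring. Qed.

HB.instance Definition _ (j b : int) :=
  isMultiplicative.Build dihedral dihedral (dih_endo j b) (dih_endoM j b).

(** The infinite dihedral group has infinitely many twisted classes for each of
    its automorphisms, and a twisted class of G maps into one of the quotient. *)
Lemma reidemeister_number_dihedral {G : groupType}
    (pi : {multiplicative G -> dihedral}) (phi : {multiplicative G -> G})
    (j b : int) :
    (forall p, exists g, pi g = p) -> j = 1 \/ j = -1 ->
    (forall g, pi (phi g) = dih_endo j b (pi g)) ->
  reidemeister_number phi = +oo%E.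
Proof.
move=> pi_surj j1 pi_phi.
(* Twisted conjugation by rotations fixes rotations if j = 1 and reflections if
   j = -1.  The only other element in the class of (x, e) has first coordinate
   - x - b or b - x, which is negative for x > |b|. *)
pose e := (j == -1).
pose x i : int := `|b| + i.+1%:Z.
have [w wE] := boolp.choice (fun i => pi_surj (x i, e)).
apply: (@reidemeister_number_infinite _ _ w) => i i' /= eq_cl.
have : reidemeister_class phi (w i') (w i).
  by rewrite -eq_cl; exists 1%g => //; rewrite multiplicative1 invg1 mulg1 mul1g.
move=> [g _ /(congr1 pi)]; rewrite !gmulfM multiplicativeV pi_phi !wE /x.
case: (pi g) => y s /(congr1 fst) /=; rewrite /e {eq_cl wE}.
by case: j1 => ->; case: s => /=; lia.
Qed.

(** * Relators and translation words *)

Lemma word_eval_wconj {X : Type} {H : groupType} (f : X -> H) (u v : word X) :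
  word_eval f (wconj u v) =
  (word_eval f u * word_eval f v * (word_eval f u)^-1)%g.
Proof. by rewrite !word_eval_cat word_eval_winv mulgA. Qed.

Lemma word_eval_wcomm {X : Type} {H : groupType} (f : X -> H) (u v : word X) :
  word_eval f (wcomm u v) = 1%g -> commute (word_eval f u) (word_eval f v).
Proof.
rewrite !word_eval_cat !word_eval_winv !mulgA => uv.
apply: (mulIg (word_eval f u)^-1%g); apply: (mulIg (word_eval f v)^-1%g).
by rewrite uv mulgK mulgV.
Qed.

Lemma commute_wpow {X : Type} {H : groupType} (f : X -> H) (z : H) (x : X)
    (c : int) : commute z (f x) -> commute z (word_eval f (wpow x c)).
Proof.
move=> zf; rewrite /wpow; elim: `|c|%N => [|n IHn]; first exact: commute1.
by apply: commuteM => //=; case: (c < 0) => //; apply: commuteV.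
Qed.

Lemma dih_eval_wpow {X : Type} (f : X -> dihedral) (x : X) (u c : int) :
  f x = rotation u -> word_eval f (wpow x c) = rotation (c * u).
Proof.
move=> fx; have powN n b : word_eval f (nseq n (x, b)) =
    rotation ((if b then - n%:Z else n%:Z) * u).
  elim: n => [|n IHn]; first by congr (_, _); case: b; ring.
  rewrite /= IHn fx; case: b {IHn}; congr (_, _); rewrite /= intS; ring.
by rewrite /wpow powN; congr (rotation (_ * _)); case: ifP => c0; lia.
Qed.

Lemma dih_eval_avec (f : pi5_gen -> dihedral) (u : 'I_2 -> int)
    (x : 'cV[int]_2) : (forall i, f (Ga i) = rotation (u i)) ->
  word_eval f (avec x) = rotation (x 0 0 * u 0 + x 1 0 * u 1).
Proof.
by move=> fu; rewrite word_eval_cat !(dih_eval_wpow _ _ _ _ (fu _)).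
Qed.

(** * Eigenvectors of a 2 x 2 integer matrix *)

Lemma det_mx2 (A : 'M[int]_2) : \det A = A 0 0 * A 1 1 - A 0 1 * A 1 0.
Proof.
have l01 : lift ord0 ord0 = 1 :> 'I_2 by apply: val_inj.
have l10 : lift 1 0 = 0 :> 'I_2 by apply: val_inj.
rewrite (expand_det_row _ 0) !big_ord_recl big_ord0 /cofactor !det_mx11 !mxE.
by rewrite !l01 !l10 /= /bump /=; ring.
Qed.

Lemma mxtrace_mx2 (A : 'M[int]_2) : \tr A = A 0 0 + A 1 1.
Proof.
have l01 : lift ord0 ord0 = 1 :> 'I_2 by apply: val_inj.
by rewrite /mxtrace !big_ord_recl big_ord0 l01 addr0.
Qed.

(** The quantity assumed nonzero is det(A - c I); each u_i is annihilated by it,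
    by Cramer's rule. *)
Lemma left_eigenvector_mx2_eq0 (A : 'M[int]_2) (c u0 u1 : int) :
    \det A - c * \tr A + c ^+ 2 != 0 ->
    c * u0 = A 0 0 * u0 + A 1 0 * u1 -> c * u1 = A 0 1 * u0 + A 1 1 * u1 ->
  u0 = 0 /\ u1 = 0.
Proof.
rewrite det_mx2 mxtrace_mx2; set D := _ + c ^+ 2 => D0 e0 e1.
split; apply/eqP; rewrite -(mulrI_eq0 _ (mulfI D0)) /D; apply/eqP.
  transitivity ((A 1 1 - c) * (A 0 0 * u0 + A 1 0 * u1 - c * u0)
    - A 1 0 * (A 0 1 * u0 + A 1 1 * u1 - c * u1)); first by ring.
  by rewrite -e0 -e1 !subrr !mulr0 subrr.
transitivity ((A 0 0 - c) * (A 0 1 * u0 + A 1 1 * u1 - c * u1)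
  - A 0 1 * (A 0 0 * u0 + A 1 0 * u1 - c * u0)); first by ring.
by rewrite -e0 -e1 !subrr !mulr0 subrr.
Qed.

Lemma ord2_cases (i : 'I_2) : i = 0 \/ i = 1.
Proof. by case: i => -[|[|//]] i2; [left | right]; apply: val_inj. Qed.

(** * Homomorphisms from Pi5 onto the infinite dihedral group *)

Section HomsToDihedral.
Context {A M : 'M[int]_2} {m k k' n : 'cV[int]_2} {f : pi5_gen -> dihedral}.
Hypothesis fP : respects (pi5_rel A M m k k' n) f.
(* Surjectivity of the homomorphism enters only in this form: the image has
   trivial centralizer, because the infinite dihedral group has trivial centre. *)
Hypothesis f_central : forall z : dihedral, (forall x, commute z (f x)) -> z = 1%g.

(** All conjugates of f (Ga i) by generators are images of words in the Ga, so
    they commute with f (Ga i); a reflection with this property would commute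
    with the generators themselves. *)
Lemma dih_translation_rotation (i : 'I_2) : exists u, f (Ga i) = rotation u.
Proof.
have fa01 : commute (f (Ga 0)) (f (Ga 1)).
  have := fP _ _ (Rel_aa A M m k k' n) => /word_eval_wcomm.
  by rewrite !word_eval_gen.
have faa i' : commute (f (Ga i)) (f (Ga i')).
  by case: (ord2_cases i) => ->; case: (ord2_cases i') => ->.
have faV x : commute (f (Ga i)) (word_eval f (avec x)).
  by rewrite word_eval_cat; apply: commuteM; apply: commute_wpow.
case fi: (f (Ga i)) => [u []]; last by exists u.
suff: f (Ga i) = 1%g by rewrite fi.
have fr : f (Ga i) = reflection u by [].
apply: f_central => -[i'|||] //;
  rewrite fr; apply: commute_conj_reflection; rewrite -fr.
- have := fP _ _ (Rel_ta A M m k k' n i).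
  by rewrite word_eval_wconj !word_eval_gen => ->.
- have := fP _ _ (Rel_alphaa A M m k k' n i).
  by rewrite word_eval_wconj word_eval_winv !word_eval_gen => ->; apply: commuteV.
- have := fP _ _ (Rel_betaa A M m k k' n i).
  by rewrite word_eval_wconj !word_eval_gen => ->.
Qed.

Hypothesis detA : \det A = 1.
Hypothesis trA : 2 < \tr A.

(** Nonzero rotation amounts would form a left eigenvector of A for the
    eigenvalue 1 or -1, and neither is an eigenvalue of a matrix with
    determinant 1 and trace > 2. *)
Lemma dih_translation_trivial (i : 'I_2) : f (Ga i) = 1%g.
Proof.
have [u0 fu0] := dih_translation_rotation 0.
have [u1 fu1] := dih_translation_rotation 1.
pose u (i : 'I_2) := if i == 0 then u0 else u1.
have fu i' : f (Ga i') = rotation (u i') by case: (ord2_cases i') => ->.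
(* Conjugation by f Gt multiplies every rotation amount by c. *)
pose c : int := if (f Gt).2 then -1 else 1.
have eq_c i' : c * u i' = A 0 i' * u0 + A 1 i' * u1.
  have := fP _ _ (Rel_ta A M m k k' n i').
  rewrite word_eval_wconj !word_eval_gen (dih_eval_avec _ _ _ fu) fu !mxE /c.
  by case: (f Gt) => y [] /(congr1 fst) /= <-; ring.
have [u00 u10] : u0 = 0 /\ u1 = 0.
  apply: (left_eigenvector_mx2_eq0 A c) (eq_c 0) (eq_c 1).
  by rewrite detA /c; case: (f Gt).2; lia.
by rewrite fu /u u00 u10; case: ifP.
Qed.

Lemma dih_eval_avec_trivial (x : 'cV[int]_2) : word_eval f (avec x) = 1%g.
Proof.
rewrite (dih_eval_avec _ (fun=> 0)) => [|i]; last exact: dih_translation_trivial.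
by rewrite !mulr0.
Qed.

(** Once the translations are trivial, the relations make the image of alpha
    commute with those of t and beta. *)
Lemma dih_alpha_trivial : f Galpha = 1%g.
Proof.
apply: f_central => -[i|||] //.
- by rewrite dih_translation_trivial; apply: commute1.
- have := fP _ _ (Rel_alphat A M m k k' n).
  rewrite word_eval_wconj word_eval_cat !word_eval_gen dih_eval_avec_trivial.
  by move=> /(canRL (mulgVK _)); rewrite mul1g.
- have := fP _ _ (Rel_alphabeta A M m k k' n).
  by rewrite dih_eval_avec_trivial => /word_eval_wcomm; rewrite !word_eval_gen.
Qed.

(** The images of t and beta cannot commute, for otherwise all images would be
    central.  A rotation squaring to 1 is trivial, and a reflection is its own
    inverse, so any other choice of types for f Gt and f Gbeta would make them
    commute through beta^2 = 1 or beta t beta^-1 = t^-1. *)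
Lemma dih_t_beta : exists j b, f Gt = rotation j /\ f Gbeta = reflection b.
Proof.
have noncomm : ~ commute (f Gbeta) (f Gt).
  move=> ftb; have f1 x : f x = 1%g.
    apply: f_central => y.
    case: x => [i|||]; case: y => [i'|||]; rewrite /commute
      ?dih_translation_trivial ?dih_alpha_trivial ?mul1g ?mulg1 //.
  have : rotation 1 = 1%g by apply: f_central => x; rewrite f1.
  by [].
have tb : (f Gbeta * f Gt * (f Gbeta)^-1 = (f Gt)^-1)%g.
  have := fP _ _ (Rel_betat A M m k k' n).
  rewrite word_eval_wconj word_eval_cat word_eval_winv !word_eval_gen.
  by rewrite dih_eval_avec_trivial mul1g.
have b2 : (f Gbeta * f Gbeta = 1)%g.
  have := fP _ _ (Rel_beta2 A M m k k' n).
  by rewrite word_eval_cat !word_eval_gen dih_eval_avec_trivial.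
case: (f Gt) (f Gbeta) noncomm tb b2 => [j s] [b r] noncomm tb b2.
case: s r noncomm tb b2 => [] [] noncomm /(congr1 fst) /= tb /(congr1 fst) /= b2;
  try (case: noncomm; congr (_, _) => /=; lia).
by exists j, b.
Qed.

End HomsToDihedral.

(** * The dihedral quotient and the R-infinity property *)

Definition dih_quotient_gen (x : pi5_gen) : dihedral :=
  match x with
  | Gt => rotation 1
  | Gbeta => reflection 0
  | _ => 1%g
  end.

Lemma dih_quotient_respects (A M : 'M[int]_2) (m k k' n : 'cV[int]_2) :
  respects (pi5_rel A M m k k' n) dih_quotient_gen.
Proof.
have avec1 x : word_eval dih_quotient_gen (avec x) = 1%g.
  by rewrite (dih_eval_avec _ (fun=> 0)) // !mulr0.
by move=> u v [] *; rewrite ?avec1 // word_eval_cat avec1.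
Qed.

Theorem theorem7p2 (A M : 'M[int]_2) (m k k' n : 'cV[int]_2)
    (detA : \det A = 1) (trA : 2 < \tr A)
    (trM : \tr M = 0) (detM : \det M = -1)
    (MAM : M *m A *m invmx M = invmx A)
    (params : pi5_params A M m k k' n) :
  R_infinity (Pi5 A M m k k' n).
Proof.
move=> phi phi_bij.
pose pi : {multiplicative Pi5 A M m k k' n -> dihedral} :=
  presented_lift dih_quotient_gen (dih_quotient_respects A M m k k' n).
have pi_gen x : pi (presented_gen x) = dih_quotient_gen x.
  by rewrite [LHS]presented_liftE word_eval_gen.
have pi_surj p : exists g, pi g = p.
  pose w := wpow Gt p.1 ++ (if p.2 then gen Gbeta else [::]).
  exists (\pi_(presented (pi5_rel A M m k k' n)) w)%qT.
  rewrite [LHS]presented_liftE word_eval_cat (dih_eval_wpow _ _ 1) //.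
  by case: p @w => x []; congr (_, _) => /=; ring.
pose psi : {multiplicative Pi5 A M m k k' n -> dihedral} := pi \o phi.
have psi_surj p : exists g, psi g = p.
  have [g <-] := pi_surj p; have [phi' _ phiK] := phi_bij.
  by exists (phi' g); rewrite /= phiK.
pose f := psi \o presented_gen.
have f_central (z : dihedral) : (forall x, commute z (f x)) -> z = 1%g.
  move=> zf; apply: dih_centerless => p; have [g <-] := psi_surj p.
  by rewrite presented_hom_eval; apply: commute_word_eval.
have fP : respects (pi5_rel A M m k k' n) f by apply: respects_hom.
have [j [b [ft fb]]] := dih_t_beta fP f_central detA trA.
(* phi descends to the endomorphism dih_endo j b of the dihedral quotient. *)
have psiE g : psi g = dih_endo j b (pi g).
  rewrite (presented_hom_eval psi) (presented_hom_eval pi) word_eval_hom.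
  congr (word_eval _ _); apply/funext => x /=.
  rewrite -[LHS]/(f x) pi_gen; case: x => [i|||].
  - by rewrite (dih_translation_trivial fP f_central detA trA) multiplicative1.
  - by rewrite ft; congr (_, _) => /=; ring.
  - by rewrite (dih_alpha_trivial fP f_central detA trA) multiplicative1.
  - by rewrite fb; congr (_, _) => /=; ring.
have j1 : j = 1 \/ j = -1.
  have [g] := psi_surj (rotation 1); rewrite psiE.
  case: (pi g) => y [] // [] /=; rewrite addr0 => /(congr1 absz)/eqP.
  by rewrite abszM muln_eq1; lia.
exact: (reidemeister_number_dihedral pi phi j b).
Qed.
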